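(* Let $\mathcal A$ be a countably infinite discrete alphabet and let $\Sigma_{\mathcal A}$ be the OTW full shift over $\mathcal A$ with the shift map $\sigma$. Let $\mathcal Q=\{q_k\}_{k\ge1}$ be an enumeration of $\Sigma_{\mathcal A}^{\mathrm{fin}}$ for which there exists an increasing sequence $i_1<i_2<\cdots$ in $\mathbb N$, with $i_n-n\ge1$ for all $n$, such that for each $n\ge1$ there exist pairwise distinct letters $a^{(n)}_1,a^{(n)}_2,a^{(n)}_3,b^{(n)}\in\mathcal A$ satisfying: (i) $q_{i_n-n}=a^{(n)}_1a^{(n)}_2a^{(n)}_3$; (ii) no word among $q_1,\dots,q_{i_n}$ starts with $a^{(n)}_2$; (iii) the letter $b^{(n)}$ does not appear in any word among $q_1,\dots,q_{i_n}$. Let $d_{\mathcal Q}$ be the OTW metric associated to $\mathcal Q$. Then $(\Sigma_{\mathcal A},\sigma,d_{\mathcal Q})$ does not have the Lipschitz shadowing property.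
   Context: Let $\Sigma_{\mathcal A}^{\mathrm{fin}}:=\{\tilde 0\}\cup\bigcup_{k\ge1}\mathcal A^k$ be the set of finite words over $\mathcal A$, where $\tilde 0$ is the empty word, and $\mathcal A^{\mathbb N}=\{x_1x_2\cdots:\ x_i\in\mathcal A\}$ the set of infinite words. The OTW full shift is the disjoint union $\Sigma_{\mathcal A}:=\mathcal A^{\mathbb N}\sqcup\Sigma_{\mathcal A}^{\mathrm{fin}}$; $|x|\in\{0,1,2,\dots,\infty\}$ denotes length. For $u\in\Sigma_{\mathcal A}^{\mathrm{fin}}$ and $x\in\Sigma_{\mathcal A}$, write $u\preceq x$ ($u$ is a prefix of $x$) if either $u=\tilde 0$, or $u=u_1\cdots u_k$ with $k\ge1$, $|x|\ge k$ and $x_1\cdots x_k=u_1\cdots u_k$. An enumeration of $\Sigma_{\mathcal A}^{\mathrm{fin}}$ is a listing $q_1,q_2,\dots$ in which each finite word appears exactly once. Given an enumeration $\mathcal Q=\{q_1,q_2,\dots\}$, the associated OTW metric is defined by $d_{\mathcal Q}(x,x)=0$ and, for $x\ne y$, $d_{\mathcal Q}(x,y)=2^{-i}$ where $i=\min\{j\ge1:\ \text{exactly one of } q_j\preceq x,\ q_j\preceq y \text{ holds}\}$. The shift map is regarded as a partially defined map (local homeomorphism) with domain $\mathrm{Dom}(\sigma)=\Sigma_{\mathcal A}\setminus\{\tilde 0\}$ (the elements of length at least $1$): $\sigma(x_1x_2x_3\cdots)=x_2x_3\cdots$, $\sigma(x_1\cdots x_k)=x_2\cdots x_k$ for $k\ge2$,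 and $\sigma(x_1)=\tilde 0$. Inductively $\mathrm{Dom}(\sigma^n)=\sigma^{-1}(\mathrm{Dom}(\sigma^{n-1}))$, so $\mathrm{Dom}(\sigma^n)=\{x:|x|\ge n\}$. For a metric $d$ on $\Sigma_{\mathcal A}$ and $\delta>0$, a sequence $(x^n)_{n\ge 0}$ in $\Sigma_{\mathcal A}$ is a $\delta$-pseudo-orbit if $x^n\in\mathrm{Dom}(\sigma)$ and $d(\sigma(x^n),x^{n+1})<\delta$ for all $n\ge0$. A point $x$ $\varepsilon$-shadows $(x^n)_{n\ge0}$ if $x\in\mathrm{Dom}(\sigma^i)$ and $d(\sigma^i(x),x^i)<\varepsilon$ for all $i\ge0$. The Lipschitz shadowing property: there exist constants $L>0$ and $\delta_0>0$ such that for every $\delta\in(0,\delta_0]$, every $\delta$-pseudo-orbit is $L\delta$-shadowed by some point of $\Sigma_{\mathcal A}$. *)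

(* Defs.v *)
From HB Require Import structures.
From mathcomp Require Import all_boot all_order all_algebra.
From mathcomp Require Import boolp classical_sets reals.

Set Implicit Arguments.
Unset Strict Implicit.
Unset Printing Implicit Defensive.

Import Order.TTheory GRing.Theory Num.Theory.

Local Open Scope ring_scope.

(* In [Inf f], the letter x_(k+1) of the infinite word x_1 x_2 ... is [f k]. *)
Inductive otw (A : Type) : Type :=
| Inf of (nat -> A)
| Fin of seq A.

Definition wprefix (A : eqType) (u : seq A) (x : otw A) : bool :=
  match x with
  | Inf f => u == mkseq f (size u)
  | Fin w => prefix u w
  end.

(* Listings q_1, q_2, ... are indexed from 1; the value [Q 0] is irrelevant. *)
Definition enumeration (A : Type) (Q : nat -> seq A) : Prop :=
  forall w : seq A, exists! j : nat, (1 <= j)%N /\ Q j = w.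

Definition separates (A : eqType) (Q : nat -> seq A) (x y : otw A)
    (j : nat) : bool :=
  (1 <= j)%N && (wprefix (Q j) x (+) wprefix (Q j) y).

Definition sep_index (A : eqType) (Q : nat -> seq A) (x y : otw A) : nat :=
  xget 0%N [set i | separates Q x y i /\
                    forall j, separates Q x y j -> (i <= j)%N]%classic.

Definition otw_dist (R : realType) (A : eqType) (Q : nat -> seq A)
    (x y : otw A) : R :=
  if `[< x = y >] then 0 else 2 ^- sep_index Q x y.

(* [None] means that the point is outside the domain of the partial map. *)
Definition shift (A : Type) (x : otw A) : option (otw A) :=
  match x with
  | Inf f => Some (Inf (fun k => f k.+1))
  | Fin [::] => None
  | Fin (_ :: w) => Some (Fin w)
  end.

Fixpoint shift_iter (A : Type) (n : nat) (x : otw A) : option (otw A) :=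
  if n is m.+1 then obind (shift_iter m) (shift x) else Some x.

Definition pseudo_orbit (R : realType) (A : Type) (d : otw A -> otw A -> R)
    (delta : R) (x : nat -> otw A) : Prop :=
  forall n, exists2 y, shift (x n) = Some y & d y (x n.+1) < delta.

Definition shadows (R : realType) (A : Type) (d : otw A -> otw A -> R)
    (eps : R) (z : otw A) (x : nat -> otw A) : Prop :=
  forall i, exists2 y, shift_iter i z = Some y & d y (x i) < eps.

Definition lipschitz_shadowing (R : realType) (A : Type)
    (d : otw A -> otw A -> R) : Prop :=
  exists L delta0 : R, [/\ 0 < L, 0 < delta0 &
    forall delta, 0 < delta -> delta <= delta0 ->
    forall x, pseudo_orbit d delta x ->
    exists z, shadows d (L * delta) z x].

(* The minimum in the metric is taken over a nonempty set: the default value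
   of [xget] in [sep_index] is never used for distinct points. *)
Lemma ex_separates (A : eqType) (Q : nat -> seq A) (x y : otw A) :
  enumeration Q -> x <> y -> exists j, separates Q x y j.
Proof.
move=> hQ xy; apply: contrapT => nsep; apply: xy.
have same u : wprefix u x = wprefix u y.
  have [j [[j1 <-] _]] := hQ u; apply: contrapT => ne; apply: nsep.
  by exists j; rewrite /separates j1 /=; move: ne; do 2!case: wprefix.
case: x y same {nsep} => [f|v] [g|w] same.
- congr Inf; apply: funext => k.
  have := same (mkseq f k.+1); rewrite /wprefix size_mkseq eqxx => /esym/eqP.
  by move=> /(congr1 (fun s => nth (f k) s k)); rewrite !nth_mkseq.
- have := same (mkseq f (size w).+1); rewrite /wprefix size_mkseq eqxx.
  by move=> /esym/size_prefix; rewrite size_mkseq ltnn.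
- have := same (mkseq g (size v).+1); rewrite /wprefix size_mkseq eqxx.
  by move=> /size_prefix; rewrite size_mkseq ltnn.
- have vw : prefix v w by have := same v; rewrite /= prefix_refl.
  have wv : prefix w v by have := same w; rewrite /= prefix_refl.
  move: vw; rewrite prefixE => /eqP vw; congr Fin; rewrite -[LHS]vw.
  by rewrite take_oversize // size_prefix.
Qed.

Lemma sep_indexP (A : eqType) (Q : nat -> seq A) (x y : otw A) :
  enumeration Q -> x <> y ->
  separates Q x y (sep_index Q x y) /\
  forall j, separates Q x y j -> (sep_index Q x y <= j)%N.
Proof.
move=> hQ xy; rewrite /sep_index; case: xgetP => [i _ //|none].
have ex := ex_separates hQ xy; case: (none (ex_minn ex)).
by case: ex_minnP => m.
Qed.

(* Main.v *)
Require Import Defs.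
From HB Require Import structures.
From mathcomp Require Import all_boot all_order all_algebra.
From mathcomp Require Import boolp classical_sets cardinality reals.

Set Implicit Arguments.
Unset Strict Implicit.
Unset Printing Implicit Defensive.

Import Order.TTheory GRing.Theory Num.Theory.

Local Open Scope ring_scope.

(** At scale [2 ^- k] the metric sees exactly the words q_1, ..., q_k: two points
    are closer than [2 ^- k] iff these words cannot tell them apart. So a factor
    [L] with [L <= 2 ^ n] blurs at most the last [n] of the words on which the
    points were known to agree. The hypotheses on the listing provide a word
    a1 a2 a3 that survives this loss, although q_1, ..., q_(i_n) together cannot
    tell [a2] from [b] as a first letter.

    Take [delta = 2 ^- i_n] with [n] large, and alternate the two points
<<
      p = a1 a2 a3 b b b ...      and      b p = b a1 a2 a3 b b b ...
>>
    Passing from [b p] to [p] is an exact shift. Passing from [p] to [b p] is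
    an error that no word among q_1, ..., q_(i_n) detects, because none of them
    starts with [a2] or with [b]. So this is a [delta]-pseudo-orbit. A point
    that [L * delta]-shadows it still agrees with it on q_(i_n - n) = a1 a2 a3.
    At time 0 this forces the point to start with a1 a2 a3, hence its second
    shift starts with [a3]; at time 2 it forces that second shift to start with
    [a1], which is a different letter. *)

Section Prefixes.
Variable A : eqType.
Implicit Types (a b : A) (u v : seq A) (x y : otw A).

Definition pcons a x : otw A :=
  match x with
  | Inf f => Inf (fun k => if k is m.+1 then f m else a)
  | Fin w => Fin (a :: w)
  end.

Lemma shift_pcons a x : shift (pcons a x) = Some x.
Proof. by case: x. Qed.

Lemma wprefix_pcons a b u x :
  wprefix (a :: u) (pcons b x) = (a == b) && wprefix u x.
Proof.
case: x => [f|w] //=.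
by rewrite /mkseq /= (iotaDl 1 0) -map_comp eqseq_cons.
Qed.

Lemma wprefix0 x : wprefix [::] x.
Proof. by case: x => [f|w] /=; rewrite ?prefix0s. Qed.

Lemma shift_SomeP x y : shift x = Some y -> exists a, x = pcons a y.
Proof.
case: x => [f|[|a w]] //= [<-]; last by exists a.
by exists (f 0%N); congr Inf; apply: funext; case.
Qed.

Lemma wprefix_shift_iter u v x y :
  wprefix (u ++ v) x -> shift_iter (size u) x = Some y -> wprefix v y.
Proof.
elim: u x => [|a u IHu] x /=; first by move=> vx [<-].
case Ex: (shift x) => [z|] //=; have [c ->] := shift_SomeP Ex.
by rewrite wprefix_pcons => /andP[_ /IHu].
Qed.

Lemma wprefix_head a b u v x :
  wprefix (a :: u) x -> wprefix (b :: v) x -> a = b.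
Proof.
case: x => [f|[|c w]] //=.
  by move=> /eqP[-> _] /eqP[-> _].
by move=> /andP[/eqP-> _] /andP[/eqP-> _].
Qed.

(** The value does not depend on [x], nor on which such [a] is chosen: words that
    start neither with [a] nor with [b] do not separate [a x] from [b y]. *)
Lemma wprefix_fresh_head a u x :
  ~~ prefix [:: a] u -> wprefix u (pcons a x) = (u == [::]).
Proof.
case: u => [|c u] au; first by rewrite wprefix0 eqxx.
rewrite wprefix_pcons; case: eqP => // ca.
by move: au; rewrite ca /= eqxx prefix0s.
Qed.

End Prefixes.

(** The ball of radius [2 ^- k] is cut out by the first [k] words; this turns
    every distance estimate below into a statement about prefixes. *)
Lemma otw_dist_ltP (R : realType) (A : eqType) (Q : nat -> seq A)
    (x y : otw A) (k : nat) : enumeration Q ->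
  otw_dist R Q x y < 2 ^- k <->
  (forall j, (1 <= j <= k)%N -> wprefix (Q j) x = wprefix (Q j) y).
Proof.
move=> Q_enum; rewrite /otw_dist; case: asboolP => [->|xy].
  by split=> // _; rewrite invr_gt0 exprn_gt0.
have [/andP[s1 sep] s_min] := sep_indexP Q_enum xy.
rewrite ltf_pV2 ?posrE ?exprn_gt0 // ltr_eXn2l ?ltr1n //.
split=> [ks j /andP[j1 jk]|same].
  apply/eqP; apply: contraTT ks => ne; rewrite -leqNgt.
  apply: leq_trans jk; apply: s_min.
  by rewrite /separates j1 /=; case: wprefix ne; case: wprefix.
by rewrite ltnNge; apply/negP => sk; move: sep; rewrite same ?s1 ?addbb.
Qed.

Theorem theorem6p2 (R : realType) (A : countType)
  (A_infinite : infinite_set [set: A]%classic)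
  (Q : nat -> seq A) (Q_enum : enumeration Q)
  (i : nat -> nat)
  (i_incr : forall n, (1 <= n)%N -> (i n < i n.+1)%N)
  (i_gt : forall n, (1 <= n)%N -> (1 <= i n - n)%N)
  (Q_words : forall n, (1 <= n)%N ->
    exists a1 a2 a3 b : A,
      [/\ uniq [:: a1; a2; a3; b],
          Q (i n - n)%N = [:: a1; a2; a3],
          forall j, (1 <= j <= i n)%N -> ~~ prefix [:: a2] (Q j) &
          forall j, (1 <= j <= i n)%N -> b \notin Q j]) :
  ~ lipschitz_shadowing (@otw_dist R A Q).
Proof.
move=> [L [delta0 [L0 delta0_gt0 shadowing]]].
(* [n] large enough that [L] costs at most [n] binary digits, and, as
   [n <= i n], that [2 ^- i n] is an admissible [delta]. *)
pose n := (maxn (Num.bound L) (Num.bound delta0^-1)).+1.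
have L_le : L <= 2 ^+ n.
  by apply/ltW/upper_nthrootP; rewrite leqW ?leq_maxl.
have delta0_le : delta0^-1 <= 2 ^+ n.
  by apply/ltW/upper_nthrootP; rewrite leqW ?leq_maxr.
have k1 : (1 <= i n - n)%N by apply: i_gt.
have ni : (n <= i n)%N by apply: ltnW; rewrite -subn_gt0.
have [a1 [a2 [a3 [b [a_uniq Qk a2_fresh b_fresh]]]]] := Q_words n isT.
have delta_le : 2 ^- i n <= delta0 :> R.
  rewrite -[delta0]invrK lef_pV2 ?posrE ?exprn_gt0 ?invr_gt0 //.
  by apply: le_trans delta0_le _; rewrite ler_eXn2l ?ltr1n.
pose q := pcons a3 (Inf (fun=> b)).
pose p := pcons a1 (pcons a2 q).
pose orbit m := if odd m then pcons b p else p.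
have orbit_pseudo : pseudo_orbit (otw_dist R Q) (2 ^- i n) orbit.
  move=> m; rewrite /orbit oddS; case: (odd m); rewrite [~~ _]/=.
    by exists p; [exact: shift_pcons | apply/otw_dist_ltP].
  exists (pcons a2 q); first exact: shift_pcons.
  apply/otw_dist_ltP => // j jn.
  rewrite !wprefix_fresh_head ?a2_fresh //.
  by apply: contra (b_fresh j jn) => /prefixP[v ->]; rewrite mem_head.
have [|z z_shadows] := shadowing _ _ delta_le _ orbit_pseudo.
  by rewrite invr_gt0 exprn_gt0.
have Lk : L * 2 ^- i n <= 2 ^- (i n - n).
  rewrite ler_pdivrMr ?exprn_gt0 // -{2}(subnK ni) exprD.
  by rewrite mulKf ?expf_neq0 ?pnatr_eq0.
have at_even m y : shift_iter m z = Some y -> ~~ odd m ->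
    wprefix [:: a1; a2; a3] y.
  move=> zy m_even; have [y' zy' d_lt] := z_shadows m.
  move: zy' d_lt; rewrite zy => -[<-]; rewrite /orbit (negbTE m_even) => d_lt.
  have /(otw_dist_ltP R y p (i n - n) Q_enum) same := lt_le_trans d_lt Lk.
  by rewrite -Qk same ?k1 ?leqnn // Qk /p /q !wprefix_pcons !eqxx wprefix0.
have z_start : wprefix ([:: a1; a2] ++ [:: a3]) z by exact: (at_even 0%N).
have [y zy _] := z_shadows 2%N.
have a31 := wprefix_head (wprefix_shift_iter z_start zy) (at_even 2%N y zy isT).
by move: a_uniq; rewrite a31 /= !inE eqxx orbT.
Qed.
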